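(* For any integer $\ell\ge 2$ and any $\epsilon>0$ there exists an infinite $\mathcal L_{2,\ell}$-free sequence $A$ of positive integers with $$A(x)\gg x^{1-\frac{\ell}{2\ell-1}-\epsilon},$$ that is, there are constants $c>0$ and $x_0$ such that $A(x)\ge c\,x^{1-\frac{\ell}{2\ell-1}-\epsilon}$ for all $x\ge x_0$.
   Context: A set $A$ of integers is called $\mathcal L_{2,\ell}$-free if $A$ contains no sumset $L_1+L_2=\{\lambda_1+\lambda_2:\lambda_i\in L_i\}$ with $L_1,L_2\subset\mathbb Z$, $|L_1|=2$ and $|L_2|=\ell$ (the sums need not be pairwise distinct). An infinite sequence of positive integers is regarded as an infinite set $A$ of positive integers, and $A(x)=|A\cap[1,x]|$ is its counting function. *)

(* Defs.v *)
From HB Require Import structures.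
From mathcomp Require Import all_boot all_order all_algebra finmap.
From mathcomp Require Import all_classical all_reals.
From mathcomp Require Import exp.

Set Implicit Arguments.
Unset Strict Implicit.
Unset Printing Implicit Defensive.

Import Order.TTheory GRing.Theory Num.Theory.

Local Open Scope classical_set_scope.
Local Open Scope card_scope.
Local Open Scope ring_scope.

Definition sumset (L1 L2 : set int) : set int :=
  [set a + b | a in L1 & b in L2].

Definition L2_free (l : nat) (A : set int) : Prop :=
  ~ exists L1 L2 : set int,
      [/\ L1 #= `I_2, L2 #= `I_l & sumset L1 L2 `<=` A].

Definition initial_part (R : realType) (A : set int) (x : R) : set int :=
  A `&` [set n : int | 1 <= n /\ n%:~R <= x].

(* [fset_set] is the empty set on infinite arguments; this case does not arise
   here, by [finite_initial_part]. *)
Definition counting (R : realType) (A : set int) (x : R) : nat :=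
  #|` fset_set (initial_part A x)|.

Lemma finite_initial_part (R : realType) (A : set int) (x : R) :
  finite_set (initial_part A x).
Proof.
apply: (@sub_finite_set _ _ (Posz @` `I_(Num.truncn x).+1)); last first.
  exact/finite_image/finite_II.
move=> [n|n] [_ [n1 nx]]; last by [].
exists n => //=; rewrite ltnS.
have x0 : 0 <= x by apply: le_trans nx; rewrite ler0z.
by rewrite truncn_ge_nat.
Qed.

(* Main.v *)
Require Import Defs.
From mathcomp Require Import all_boot all_order all_algebra finmap.
From mathcomp Require Import all_classical all_reals.
From mathcomp Require Import exp.
From mathcomp Require Import zify ring lra.

(** Put m = l - 1.  A set is L_{2,l}-free exactly when every positive
    difference d has at most m representations d = a' - a in it, so the task is
    to build a dense set of integers whose differences are represented at most
    m times.  The set is built greedily, one element at a time; the elements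
    are not added in increasing order.

    The plain greedy algorithm only avoids, for the next element n, the
    differences that already have m representations, and the count of these
    guarantees only the exponent 1/3, whatever l is.  To do better one also keeps small the number N_r of differences
    having at least r representations, for every r <= m.  Heuristically a random
    j-element subset of [1, X] has N_(r+1) about (j^2 / X) * N_r, and this is
    the behaviour that is maintained.  With y the m-th root of j rounded up and
    X = (2m+1) j^2 y, the invariant (the record sparse) is N_r <= j y^(m+1-r).

    When n joins s, and n is not a midpoint of two elements of s, N_(r+1) grows
    by at most load s r n, the number of a in s such that |n - a| has at least r
    representations (size_popular_cons).  Summed over n, these loads are at most
    2 j N_r (sum_load), because a and d = |n - a| determine n up to two choices.
    By averaging, for each r at most 2 j^2 y values of n have a load
    as large as y^(m-r) (count_load_large), and at most j^2 are midpoints.  So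
    some n <= X has load less than y^(m-r) for all r from 1 to m at once
    (sparse_extend), which preserves the invariant.  For r = m the load is less
    than 1, hence 0, so that no difference acquires an (m+1)-st representation.

    The union of the resulting chain (sparse_tower) is the desired set A: a
    forbidden sumset is finite, so it would already lie in one member of the
    chain, and A has at least j elements up to about j^(2+1/m), that is,
    A(x) >> x^(m/(2m+1)), with m/(2m+1) = 1 - l/(2l-1). *)

Import Order.TTheory GRing.Theory Num.Theory.

(** * Representations of differences *)

Definition dist (a b : nat) : nat := (a - b) + (b - a).

Definition rep (s : seq nat) (d : nat) : nat := count (fun a => a + d \in s) s.

Definition popular (s : seq nat) (r : nat) : seq nat :=
  [seq d <- undup [seq dist a b | a <- s, b <- s] | (0 < d) && (r <= rep s d)].

(** The differences created by a new element n that reach r + 1 representations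
    are among those counted here.  The condition a != n excludes the zero
    distance, which always has size s representations. *)
Definition load (s : seq nat) (r n : nat) : nat :=
  count (fun a => (a != n) && (r <= rep s (dist n a))) s.

Definition midpoints (s : seq nat) : seq nat :=
  [seq (a + b)./2 | a <- s, b <- s].

Lemma mem_popular (s : seq nat) (r d : nat) :
  0 < r -> (d \in popular s r) = (0 < d) && (r <= rep s d).
Proof.
move=> r0; rewrite mem_filter andb_idr// => /andP[_ rd].
have /hasP[a sa sad] : has (fun a => a + d \in s) s.
  by rewrite has_count; apply: leq_trans rd.
rewrite mem_undup; apply/allpairsP; exists (a, a + d) => /=.
by split=> //; rewrite /dist; lia.
Qed.

Lemma popular_uniq (s : seq nat) (r : nat) : uniq (popular s r).
Proof. exact/filter_uniq/undup_uniq. Qed.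

Lemma notin_midpoints (s : seq nat) (n a b : nat) :
  n \notin midpoints s -> a \in s -> b \in s -> a + b != n.*2.
Proof.
move=> /allpairsP nmid sa sb; apply/eqP => abn; apply: nmid.
by exists (a, b); split=> //=; rewrite abn doubleK.
Qed.

(** A new representation of d uses n as its larger or as its smaller end; both
    at once would put n halfway between n - d and n + d. *)
Lemma rep_cons (s : seq nat) (n d : nat) :
  uniq s -> n \notin midpoints s -> 0 < d ->
  rep (n :: s) d <= rep s d + (d \in [seq dist n a | a <- s]).
Proof.
move=> us nmid d0; rewrite /rep /=.
have -> : (n + d \in n :: s) = (n + d \in s).
  by rewrite inE (_ : (n + d == n) = false)//; lia.
have split_count : count (fun a => a + d \in n :: s) s <=
    count (fun a => a + d \in s) s + ((d <= n) && (n - d \in s)).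
  apply: (@leq_trans (count (predU (fun a => a + d \in s)
                       (fun a => a + d == n)) s)).
    by apply: sub_count => a; rewrite inE orbC.
  have := count_predUI (fun a => a + d \in s) (fun a => a + d == n) s.
  have : count (fun a => a + d == n) s <= ((d <= n) && (n - d \in s)).
    have [dn|nd] := leqP d n; last first.
      by rewrite (@eq_count _ _ pred0) ?count_pred0// => a /=; lia.
    rewrite (@eq_count _ _ (pred1 (n - d))); last by move=> a /=; lia.
    by rewrite count_uniq_mem.
  by lia.
have [up|up] := boolP (n + d \in s).
  have -> : d \in [seq dist n a | a <- s].
    by apply/mapP; exists (n + d) => //; rewrite /dist; lia.
  have dnF : ~~ ((d <= n) && (n - d \in s)).
    apply/negP => /andP[dn nd].
    by have := notin_midpoints _ _ _ _ nmid up nd; lia.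
  by rewrite addnC leq_add2r (leq_trans split_count)// (negbTE dnF) addn0.
have [/andP[dn nd]|dnF] := boolP ((d <= n) && (n - d \in s)).
  have -> : d \in [seq dist n a | a <- s].
    by apply/mapP; exists (n - d) => //; rewrite /dist; lia.
  by rewrite dn nd in split_count.
by rewrite add0n (leq_trans split_count)// (negbTE dnF) addn0 leq_addr.
Qed.

Lemma size_popular_cons (s : seq nat) (n r : nat) :
  uniq s -> n \notin midpoints s ->
  size (popular (n :: s) r.+1) <= size (popular s r.+1) + load s r n.
Proof.
move=> us nmid.
rewrite /load -size_filter -[X in _ + X](size_map (dist n)) -size_cat.
apply: (uniq_leq_size (popular_uniq _ _)) => d.
rewrite mem_popular// mem_cat mem_popular// => /andP[d0 rd]; rewrite d0 /=.
have := leq_trans rd (rep_cons _ _ _ us nmid d0).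
case: (leqP r.+1 (rep s d)) => //= rs.
case: mapP => [[a sa dE]|_]; last by rewrite addn0 ltnNge -ltnS rs.
rewrite addn1 ltnS => rle; apply/mapP; exists a => //.
rewrite mem_filter sa -dE rle !andbT.
by apply: contraTneq d0 => an; rewrite dE an /dist; lia.
Qed.

(** A point at a given distance from a is one of a + d, a - d. *)
Lemma count_dist (D : seq nat) (a X : nat) :
  count (fun n => dist n a \in D) (index_iota 1 X) <= 2 * size D.
Proof.
rewrite -size_filter mul2n -addnn.
rewrite -[X in X + _](size_map (fun d => a + d)).
rewrite -[X in _ + X](size_map (fun d => a - d)) -size_cat.
apply: uniq_leq_size; first exact/filter_uniq/iota_uniq.
move=> n; rewrite mem_filter mem_cat => /andP[dD _]; apply/orP.
have [an|na] := leqP a n; [left|right]; apply/mapP; exists (dist n a) => //;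
  by rewrite /dist; lia.
Qed.

(** This average bound is what lets one choose n with a small load: exchange the
    two summations and count, for each a, the n at a popular distance. *)
Lemma sum_load (s : seq nat) (r X : nat) : 0 < r ->
  \sum_(1 <= n < X) load s r n <= 2 * size s * size (popular s r).
Proof.
move=> r0.
rewrite (eq_bigr (fun n => \sum_(a <- s)
  ((a != n) && (r <= rep s (dist n a)) : nat))); last first.
  by move=> n _; rewrite /load -sum1_count big_mkcond; apply: eq_bigr => a _; case: ifP.
rewrite exchange_big /= -mulnA mulnCA -(sum1_size s) big_distrl /=.
apply: leq_sum => a _; rewrite mul1n.
apply: leq_trans (count_dist _ a X).
rewrite -sum1_count [leqRHS]big_mkcond /=; apply: leq_sum => n _.
case: ifP => [_|]; first by case: (_ && _).
rewrite mem_popular// => nD; case: andP => // -[an rle].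
by move: nD; rewrite rle andbT /dist; lia.
Qed.

(** * The greedy step *)

(** The invariant of the construction, to be used with y the least integer such
    that size s <= y ^ m.  The bound for r = 1 is then at least size s ^ 2, more
    than there are differences, and each further representation divides it by
    y, which is the order of X / size s ^ 2. *)
Record sparse (m y : nat) (s : seq nat) : Prop := Sparse {
  sparse_uniq : uniq s;
  sparse_range : forall a, a \in s ->
    0 < a <= m.*2.+1 * size s ^ 2 * y;
  sparse_popular : forall r, 0 < r <= m ->
    size (popular s r) <= size s * y ^ (m.+1 - r);
  sparse_rep : forall d, 0 < d -> rep s d <= m }.

Lemma sparse_nil (m y : nat) : sparse m y [::].
Proof. by split. Qed.

Lemma sparse_le (m y y' : nat) (s : seq nat) :
  y <= y' -> sparse m y s -> sparse m y' s.
Proof.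
move=> yy' [us sr sp srep]; split=> // [a /sr/andP[-> /=]|r rm].
  by move=> /leq_trans; apply; rewrite leq_mul2l yy' orbT.
apply: leq_trans (sp r rm) _; rewrite leq_mul2l leq_exp2r ?yy' ?orbT//.
by lia.
Qed.

(** Markov's inequality for sum_load. *)
Lemma count_load_large (m y r X : nat) (s : seq nat) :
  0 < y -> 0 < r <= m -> sparse m y s ->
  count (fun n => y ^ (m - r) <= load s r n) (index_iota 1 X)
    <= 2 * size s ^ 2 * y.
Proof.
move=> y0 rm sps; have yr0 : 0 < y ^ (m - r) by rewrite expn_gt0 y0.
rewrite -(leq_pmul2r yr0).
apply: (@leq_trans (\sum_(1 <= n < X) load s r n)).
  rewrite -sum1_count big_distrl /= big_mkcond; apply: leq_sum => n _.
  by case: ifP; rewrite ?mul1n.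
apply: leq_trans (sum_load _ _ _ _) _; first by case/andP: rm.
apply: leq_trans (leq_mul (leqnn _) (sparse_popular _ _ _ sps r rm)) _.
by rewrite subSn ?expnS -?mulnn; [lia | case/andP: rm].
Qed.

Lemma count_or_le (T : Type) (p q : pred T) (s : seq T) :
  count (fun x => p x || q x) s <= count p s + count q s.
Proof. by rewrite -(count_predUI p q) leq_addr. Qed.

Lemma count_has_le_sum (T I : Type) (P : T -> I -> bool) (rs : seq I) (s : seq T) :
  count (fun x => has (P x) rs) s <= \sum_(r <- rs) count (P^~ r) s.
Proof.
elim: rs => [|r rs IH]; first by rewrite count_pred0.
rewrite big_cons /=; apply: leq_trans (count_or_le _ _ _ _) _.
by rewrite leq_add2l.
Qed.

(** The range [1, X] has more elements than there are midpoints and points of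
    large load together; any remaining point extends s. *)
Lemma sparse_extend (m y : nat) (s : seq nat) :
  0 < m -> size s < y ^ m -> sparse m y s -> exists n, sparse m y (n :: s).
Proof.
move=> m0 sy sps.
have y0 : 0 < y by case: y sy {sps} => //; rewrite exp0n.
set X := m.*2.+1 * (size s).+1 ^ 2 * y.
have [n [nX nmid nload]] : exists n, [/\ 0 < n <= X, n \notin midpoints s &
    forall r, 0 < r <= m -> load s r n < y ^ (m - r)].
  pose bad n := (n \in midpoints s) ||
    has (fun r => y ^ (m - r) <= load s r n) (index_iota 1 m.+1).
  have /hasP[n nX nbad] : has (predC bad) (index_iota 1 X.+1).
    rewrite has_predC all_count size_iota subn1 /=; apply/negP => /eqP badX.
    suff : X <= size s ^ 2 + m * (2 * size s ^ 2 * y).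
      have ST : size s ^ 2 < (size s).+1 ^ 2 by rewrite ltn_exp2r.
      have mST : m * size s ^ 2 * y <= m * (size s).+1 ^ 2 * y.
        by rewrite leq_mul2r leq_mul2l (ltnW ST) !orbT.
      have := leq_pmulr ((size s).+1 ^ 2) y0.
      by rewrite /X; lia.
    rewrite -{1}badX; apply: leq_trans (count_or_le _ _ _ _) (leq_add _ _).
      rewrite -size_filter -mulnn -(size_allpairs (fun a b => (a + b)./2)).
      apply: uniq_leq_size; first exact/filter_uniq/iota_uniq.
      by move=> n; rewrite mem_filter => /andP[].
    apply: leq_trans (count_has_le_sum _ _ _ _ _) _.
    rewrite -[X in X * _](subn1 m.+1) -sum_nat_const_nat.
    rewrite !big_seq; apply: leq_sum => r; rewrite mem_index_iota => rm.
    exact: count_load_large.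
  exists n; move: nX; rewrite mem_index_iota ltnS => nX.
  move: nbad; rewrite /= negb_or => /andP[nmid /hasPn nload]; split=> // r rm.
  by rewrite ltnNge nload// mem_index_iota ltnS.
have ns : n \notin s.
  apply: contra nmid => sn; apply/allpairsP; exists (n, n).
  by rewrite /= addnn doubleK.
have us := sparse_uniq _ _ _ sps.
exists n; split.
- by rewrite /= ns.
- move=> a; rewrite inE => /predU1P[->//|/(sparse_range _ _ _ sps)/andP[-> /=]].
  move=> /leq_trans; apply; rewrite leq_mul2r leq_mul2l leq_exp2r//.
  by rewrite leqnSn !orbT.
- case=> // r rm; apply: leq_trans (size_popular_cons _ _ _ us nmid) _.
  rewrite /= mulSn addnC; apply: leq_add; last exact: sparse_popular.
  (* There are at most size s new differences, fewer than y ^ m: this is the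
     case r = 0, for which n was not chosen. *)
  case: r rm => [|r] rm; last by rewrite subSS ltnW// nload//; lia.
  by rewrite subSS subn0; apply: leq_trans (count_size _ _) (ltnW sy).
- move=> d d0; rewrite leqNgt; apply/negP => md.
  have dn : d \in popular (n :: s) m.+1 by rewrite mem_popular// d0.
  (* Before the step no difference has m + 1 representations, and a load less
     than y ^ 0 creates none. *)
  have : size (popular (n :: s) m.+1) <= 0.
    apply: leq_trans (size_popular_cons _ _ _ us nmid) _.
    have := nload m; rewrite subnn expn0 m0 leqnn ltnS leqn0 => /(_ isT)/eqP ->.
    rewrite addn0 leqn0 size_eq0; apply/eqP/eqP; rewrite -size_eq0 -leqn0 leqNgt.
    rewrite -has_predT; apply/hasPn => e; rewrite mem_popular// => /andP[e0].
    by rewrite ltnNge (sparse_rep _ _ _ sps).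
  by rewrite leqn0 size_eq0 => /eqP pn; rewrite pn in dn.
Qed.

(** * The chain of finite sets *)

(** The m-th root of j, rounded up: for 0 < m the search range contains j,
    which satisfies j <= j ^ m, so the search succeeds. *)
Definition ceil_root (m j : nat) : nat :=
  find (fun y => j <= y ^ m) (iota 0 j.+1).

Lemma ceil_rootP (m j : nat) : 0 < m -> j <= ceil_root m j ^ m.
Proof.
move=> m0; have hasj : has (fun y => j <= y ^ m) (iota 0 j.+1).
  apply/hasP; exists j; first by rewrite mem_iota add0n ltnSn.
  by case: j => // j; rewrite -[X in X <= _]expn1 leq_pexp2l.
have := nth_find 0 hasj; rewrite nth_iota ?add0n//.
by rewrite -[X in _ < X](size_iota 0) -has_find.
Qed.

Lemma ceil_root_min (m j y : nat) : j <= y ^ m -> ceil_root m j <= y.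
Proof.
move=> jy; rewrite leqNgt; apply/negP => yj.
have := before_find 0 yj; rewrite nth_iota ?add0n ?jy//.
by rewrite -[X in _ < X](size_iota 0); apply: leq_trans yj (find_size _ _).
Qed.

Lemma ceil_root_le (m i j : nat) : 0 < m -> i <= j ->
  ceil_root m i <= ceil_root m j.
Proof.
by move=> m0 ij; apply/ceil_root_min/(leq_trans ij)/ceil_rootP.
Qed.

(** The factor 2 ^ m pays for the rounding: c <= 2 (c - 1) once 1 < c. *)
Lemma ceil_root_ub (m j : nat) : 0 < m -> ceil_root m j ^ m <= 2 ^ m * j.
Proof.
move=> m0; case: j => [|j].
  by rewrite (_ : ceil_root m 0 = 0)// exp0n.
case: (ltnP 1 (ceil_root m j.+1)) => [c1|c1]; last first.
  apply: (@leq_trans (1 ^ m)); first by rewrite leq_exp2r.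
  by rewrite exp1n muln_gt0 expn_gt0.
have : (ceil_root m j.+1).-1 ^ m < j.+1.
  rewrite ltnNge; apply/negP => /ceil_root_min; lia.
move=> /ltnW; rewrite -(leq_pmul2l (expn_gt0 2 m)) -expnMn; apply: leq_trans.
by rewrite leq_exp2r//; lia.
Qed.

Lemma sparse_tower (m : nat) : 0 < m -> exists S : nat -> seq nat,
  [/\ forall j, size (S j) = j,
      forall j, sparse m (ceil_root m j) (S j)
    & forall i j, i <= j -> {subset S i <= S j}].
Proof.
move=> m0; pose ok s := sparse m (ceil_root m (size s)) s.
have step s : exists n, ok s -> ok (n :: s).
  have [oks|nok] := pselect (ok s); last by exists 0.
  have [|n okn] := sparse_extend m (ceil_root m (size s).+1) s m0 _
    (sparse_le _ _ _ _ (ceil_root_le _ _ _ m0 (leqnSn _)) oks).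
    exact: ceil_rootP.
  by exists n.
have [f okf] := choice step.
pose S := fix S j := if j is i.+1 then f (S i) :: S i else [::].
have sizeS j : size (S j) = j by elim: j => //= j ->.
exists S; split=> //.
- move=> j; rewrite -[X in ceil_root _ X]sizeS.
  by elim: j => [|j IH]; [exact: sparse_nil | exact: okf].
- apply: homo_leq => [s //|s t u st tu x /st /tu //|j x xS].
  by rewrite inE xS orbT.
Qed.

(** * The infinite set *)

Local Open Scope classical_set_scope.
Local Open Scope ring_scope.

Definition tower_union (S : nat -> seq nat) : set int :=
  \bigcup_j [set` [seq Posz a | a <- S j]].

Lemma tower_union_seq (S : nat -> seq nat) (t : seq int) :
  (forall i j, (i <= j)%N -> {subset S i <= S j}) ->
  [set` t] `<=` tower_union S ->
  exists j, {subset t <= [seq Posz a | a <- S j]}.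
Proof.
move=> mono; elim: t => [|x t IH] tS; first by exists 0%N.
have [|i ti] := IH; first by move=> y yt; apply: tS; rewrite /= inE yt orbT.
have [|j _ /= xj] := tS x; first by rewrite /= mem_head.
exists (maxn i j) => y; rewrite inE => /predU1P[->|/ti].
  by case/mapP: xj => a aS ->; apply: map_f; apply: mono aS; exact: leq_maxr.
by case/mapP=> a aS ->; apply: map_f; apply: mono aS; exact: leq_maxl.
Qed.

Lemma card_eq_II_seq (L : set int) (n : nat) : (L #= `I_n)%card ->
  exists t : seq int, [/\ uniq t, size t = n & [set` t] = L].
Proof.
move=> Ln; have Lfin : finite_set L by apply/finite_setP; exists n.
exists (fset_set L); split; first exact: fset_uniq.
- exact: card_fset_set.
- by rewrite -[RHS]fset_setK.
Qed.

(** If u < v lie in L1, each b in L2 yields a representation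
    v - u = (v + b) - (u + b), so L2 would be too large. *)
Lemma tower_union_L2_free (m : nat) (S : nat -> seq nat) :
  (forall i j, (i <= j)%N -> {subset S i <= S j}) ->
  (forall j d, (0 < d)%N -> (rep (S j) d <= m)%N) ->
  L2_free m.+1 (tower_union S).
Proof.
move=> mono repS [L1 [L2 [/card_eq_II_seq[t1 [ut1 st1 <-]]]]].
move=> /card_eq_II_seq[t2 [ut2 st2 <-]].
have [u [v [uv ut vt]]] : exists u v : int, [/\ u < v, u \in t1 & v \in t1].
  case: t1 ut1 st1 => [|u [|v []]] //=; rewrite inE andbT => uv _.
  case: (ltgtP u v) uv => // uv _; [exists u, v|exists v, u];
    by rewrite !inE !eqxx ?orbT.
move=> sumA; have [|j jP] := @tower_union_seq S
  ([seq u + b | b <- t2] ++ [seq v + b | b <- t2]) mono.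
  move=> x /=; rewrite mem_cat => /orP[] /mapP[b bt ->]; apply: sumA.
    by exists u => //; exists b.
  by exists v => //; exists b.
have jS b : b \in t2 -> exists a c : nat,
    [/\ a \in S j, c \in S j, u + b = a & v + b = c].
  move=> bt.
  have /jP/mapP[a aS ua] : u + b \in [seq u + b | b <- t2] ++ [seq v + b | b <- t2].
    by rewrite mem_cat map_f.
  have /jP/mapP[c cS vc] : v + b \in [seq u + b | b <- t2] ++ [seq v + b | b <- t2].
    by rewrite mem_cat orbC map_f.
  by exists a, c.
have := repS j (absz (v - u)); rewrite absz_gt0 subr_eq0 (gt_eqF uv) => /(_ isT).
apply/negP; rewrite -ltnNge -st2 -(size_map (fun b => absz (u + b))) /rep.
rewrite -size_filter; apply: uniq_leq_size.
  rewrite map_inj_in_uniq// => b c /jS[a [_ [_ _ ab _]]] /jS[a' [_ [_ _ ac _]]].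
  by rewrite ab ac !absz_nat => aa; apply: (addrI u); rewrite ab ac aa.
move=> _ /mapP[b /jS[a [c [aS cS ab cb]]] ->].
rewrite mem_filter ab absz_nat aS andbT /=.
suff -> : (a + absz (v - u))%N = c by [].
by lia.
Qed.

Lemma counting_tower_union (R : realType) (S : nat -> seq nat) (j : nat) (x : R) :
  uniq (S j) -> (forall a, a \in S j -> (0 < a)%N /\ a%:R <= x) ->
  (size (S j) <= counting (tower_union S) x)%N.
Proof.
move=> uS Sx; rewrite /counting -(size_map Posz); apply: uniq_leq_size.
  by rewrite map_inj_uniq// => a b [].
move=> _ /mapP[a aS ->]; have [a0 ax] := Sx _ aS.
rewrite in_fset_set ?inE; last exact: finite_initial_part.
by split; [exists j => //=; exact: map_f | split].
Qed.

Lemma tower_union_infinite (S : nat -> seq nat) :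
  (forall j, uniq (S j)) -> (forall j, size (S j) = j) ->
  infinite_set (tower_union S).
Proof.
move=> uS sizeS finS; pose N := #|` fset_set (tower_union S)|.
suff : (size (S N.+1) <= N)%N by rewrite sizeS ltnn.
rewrite -(size_map Posz); apply: uniq_leq_size.
  by rewrite map_inj_uniq// => a b [].
by move=> a aS; rewrite in_fset_set// inE; exists N.+1.
Qed.

(** * Growth of the counting function *)

(** Raising to the power m clears the root: up to a constant the range used by
    the j-th set is j^(2+1/m). *)
Lemma scale_le (m j : nat) : (0 < m)%N ->
  ((m.*2.+1 * j ^ 2 * ceil_root m j) ^ m
     <= (2 * m.*2.+1) ^ m * j ^ m.*2.+1)%N.
Proof.
move=> m0; rewrite !expnMn -expnD addnn expnSr.
by have := leq_mul (leqnn (m.*2.+1 ^ m * j ^ m.*2)%N) (ceil_root_ub m j m0); lia.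
Qed.

(** Take j to be the integer part of t = x^p / K.  Then scale_le bounds the m-th
    power of the range by K^m t^(2m+1), which is at most x^m; the lower bound on
    x makes t >= 1, so that rounding t down loses at most a factor 2. *)
Lemma exists_scale (R : realType) (m : nat) (x : R) : (0 < m)%N ->
  let K := (2 * m.*2.+1)%:R in let p := m%:R / (m.*2.+1)%:R in
  K `^ p^-1 <= x ->
  exists j, (m.*2.+1 * j ^ 2 * ceil_root m j)%:R <= x /\
            (K * 2)^-1 * x `^ p <= j%:R.
Proof.
move=> m0 K p Kx.
have K1 : 1 <= K by rewrite ler1n.
have K0 : 0 < K by apply: lt_le_trans K1.
have p0 : 0 < p by rewrite divr_gt0// ltr0n.
have x0 : 0 <= x by apply: le_trans Kx; exact: powR_ge0.
pose t := K^-1 * x `^ p; pose j := Num.truncn t.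
have t1 : 1 <= t.
  rewrite ler_pdivlMl// mulr1.
  have := ge0_ler_powR (ltW p0) (powR_ge0 _ _) x0 Kx.
  by rewrite -powRrM mulVf ?gt_eqF// powRr1// ltW.
have t0 : 0 <= t by apply: le_trans t1.
have jt : j%:R <= t by rewrite truncn_le.
have tj : t < j.+1%:R by exact: truncnS_gt.
have j1 : 1 <= j%:R :> R by rewrite ler1n truncn_gt0.
exists j; split; last first.
  by rewrite invfM mulrAC -/t ler_pdivrMr//; move: tj; rewrite -addn1 natrD; lra.
rewrite -(@ler_pXn2r _ m)// ?nnegrE//.
have tE : t ^+ m.*2.+1 = K^-1 ^+ m.*2.+1 * x ^+ m.
  rewrite exprMn -(powR_mulrn _ (powR_ge0 x p)) -powRrM divfK ?pnatr_eq0//.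
  by rewrite powR_mulrn.
have := scale_le m j m0; rewrite -(ler_nat R) [in leRHS]natrM !natrX -/K.
move=> /le_trans; apply.
apply: (@le_trans _ _ (K ^+ m * t ^+ m.*2.+1)).
  by rewrite ler_pM2l ?exprn_gt0// ler_pXn2r// nnegrE.
rewrite tE mulrA ler_piMl ?exprn_ge0//.
rewrite exprVn ler_pdivrMr ?exprn_gt0// mul1r ler_weXn2l//.
by rewrite -addnn; lia.
Qed.

Theorem theorem6 (R : realType) (l : nat) (hl : (2 <= l)%N)
    (eps : R) (heps : 0 < eps) :
  exists A : set int,
    [/\ A `<=` [set n : int | 0 < n],
        infinite_set A,
        L2_free l A
      & exists c x0 : R, 0 < c /\
          forall x : R, x0 <= x ->
            c * x `^ (1 - l%:R / (2 * l%:R - 1) - eps) <= (counting A x)%:R].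
Proof.
case: l hl => // m; rewrite ltnS => m0.
have [S [sizeS sparseS monoS]] := sparse_tower m m0.
exists (tower_union S); split.
- move=> _ [j _ /= /mapP[a /(sparse_range _ _ _ (sparseS j))/andP[a0 _] ->]].
  by rewrite ltz_nat.
- apply: tower_union_infinite sizeS => j; exact: sparse_uniq (sparseS j).
- by apply: tower_union_L2_free => // j; apply: sparse_rep (sparseS j).
pose K : R := (2 * m.*2.+1)%:R; pose p : R := m%:R / (m.*2.+1)%:R.
exists (K * 2)^-1, (Num.max 1 (K `^ p^-1)); split.
  by rewrite invr_gt0 mulr_gt0// ltr0n.
move=> x; rewrite ge_max => /andP[x1 Kx].
have [j [Xx xj]] := exists_scale R m x m0 Kx.
apply: (@le_trans _ _ ((K * 2)^-1 * x `^ p)).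
  rewrite ler_pM2l ?invr_gt0 ?mulr_gt0 ?ltr0n//.
  apply: ler_powR => //.
  suff -> : 1 - m.+1%:R / (2 * m.+1%:R - 1) = p by lra.
  have m_ge0 : 0 <= m%:R :> R by [].
  have -> : p = m%:R / (2 * m%:R + 1) by rewrite /p -mul2n -natr1 natrM.
  rewrite -natr1; field.
  by apply: lt0r_neq0; lra.
apply: le_trans xj _; rewrite ler_nat -[leqLHS]sizeS.
apply: counting_tower_union => [|a aS]; first exact: sparse_uniq (sparseS j).
have := sparse_range _ _ _ (sparseS j) _ aS; rewrite sizeS => /andP[-> aX].
by split=> //; apply: le_trans Xx; rewrite ler_nat.
Qed.
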